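(* Let $R\in\mathcal{E}(\Omega)$. Then $R$ is moderate (resp. negligible) with respect to type $[\mathrm{A}_\mathrm{g}]$ if and only if it is moderate (resp. negligible) with respect to type $[\mathrm{A}_\mathrm{g}^\infty]$.
   Context: Notation: $\mathbb{N}=\{1,2,\dots\}$, $\mathbb{N}_0=\mathbb{N}\cup\{0\}$, $I=(0,1]$; $\Omega\subseteq\mathbb{R}^s$ open; $K\subset\subset\Omega$ means $K$ is a compact subset of $\Omega$. $\mathcal{D}(\Omega)$: compactly supported smooth functions with usual (LF) topology. $\mathcal{A}_0(\Omega)=\{\varphi\in\mathcal{D}(\Omega):\int\varphi=1\}$. $\langle\xi^\alpha,\varphi\rangle=\int\xi^\alpha\varphi(\xi)\,d\xi$. Smoothness is in the sense of convenient calculus (Kriegl–Michor): smooth curves are mapped to smooth curves. $S_\varepsilon\varphi(\xi)=\varepsilon^{-s}\varphi(\xi/\varepsilon)$, $T(\varphi,x)=(\varphi(\cdot-x),x)$, $U(\Omega)=T^{-1}(\mathcal{A}_0(\Omega)\times\Omega)$, and $\mathcal{E}(\Omega)=\mathcal{C}^\infty(U(\Omega))$ is the set of $R:U(\Omega)\to\mathbb{C}$ with $R\circ T^{-1}:\mathcal{A}_0(\Omega)\times\Omega\to\mathbb{C}$ smooth. All $O$-estimates are for $\varepsilon\to0$. Test objects are elements of $\mathcal{C}_b^\infty(I\times\Omega,\mathcal{A}_0(\mathbb{R}^s))$, the set of smooth $\phi:I\times\Omega\to\mathcal{A}_0(\mathbb{R}^s)$ such that for all $K\subset\subset\Omega$,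 $\alpha\in\mathbb{N}_0^s$ the set $\{\partial_x^\alpha\phi(\varepsilon,x):\varepsilon\in I,x\in K\}$ is bounded in $\mathcal{D}(\mathbb{R}^s)$. For $q\in\mathbb{N}$ a test object $\phi$ is of type $[\mathrm{A}_\mathrm{g}]_q$ if $\sup_{x\in L}|\langle\xi^\alpha,\phi(\varepsilon,x)\rangle|=O(\varepsilon^q)$ for all $L\subset\subset\Omega$ and $\alpha\in\mathbb{N}_0^s$ with $1\le|\alpha|\le q$; it is of type $[\mathrm{A}_\mathrm{g}^\infty]_q$ if $\sup_{x\in L}|\langle\xi^\alpha,\partial_x^\beta\phi(\varepsilon,x)\rangle|=O(\varepsilon^q)$ for all $L\subset\subset\Omega$, all $\beta\in\mathbb{N}_0^s$ and all $\alpha$ with $1\le|\alpha|\le q$. For each of these types $[X]$: $R$ is moderate with respect to type $[X]$ if $\forall K\subset\subset\Omega\ \forall\alpha\in\mathbb{N}_0^s\ \exists N\in\mathbb{N}$: for all test objects $\phi$ of type $[X]_N$, $\sup_{x\in K}|\partial^\alpha(R(S_\varepsilon\phi(\varepsilon,x),x))|=O(\varepsilon^{-N})$. $R$ is negligible with respect to type $[X]$ if $\forall K\ \forall\alpha\ \forall n\in\mathbb{N}\ \exists q\in\mathbb{N}$: for all test objects $\phi$ of type $[X]_q$, $\sup_{x\in K}|\partial^\alpha(R(S_\varepsilon\phi(\varepsilon,x),x))|=O(\varepsilon^{n})$. *)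

(* Defs.v *)
From HB Require Import structures.
From mathcomp Require Import all_boot all_order all_algebra.
From mathcomp Require Import complex.
From mathcomp Require Import all_classical all_reals all_analysis.

Set Implicit Arguments.
Unset Strict Implicit.
Unset Printing Implicit Defensive.

Import Order.TTheory GRing.Theory Num.Theory.
Import numFieldNormedType.Exports.

Local Open Scope classical_set_scope.
Local Open Scope ring_scope.

(* [Rcomplex R] is R[i] seen as a two-dimensional real vector space, with the
   R-valued modulus as norm; here it becomes a [normedModType R], so that the
   library's [derivable], ['D_v f] and [continuous] apply to complex-valued
   functions of real variables. *)
Section RcomplexNormedModule.
Variable R : realType.

Lemma Rcomplex_normrZ (l : R) (z : Rcomplex R) : `|l *: z| = `|l| * `|z|.
Proof.
case: z => a b; rewrite -![LHS]/(Normc.normc _) -[X in _ * X]/(Normc.normc _) /=.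
by rewrite !exprMn -mulrDr sqrtrM ?sqr_ge0// sqrtr_sqr.
Qed.

HB.instance Definition _ :=
  PseudoMetric.copy (Rcomplex R) (pseudoMetric_normed (Rcomplex R)).
HB.instance Definition _ := isPointed.Build (Rcomplex R) 0.
HB.instance Definition _ :=
  NormedZmod_PseudoMetric_eq.Build R (Rcomplex R) erefl.
HB.instance Definition _ :=
  PseudoMetricNormedZmod_Lmodule_isNormedModule.Build R (Rcomplex R)
    Rcomplex_normrZ.

End RcomplexNormedModule.

Section MultiIndices.
Variables (R : realType) (s : nat).
Local Notation E := 'rV[R]_s.

Definition mindex := 'I_s -> nat.

Definition mi_size (a : mindex) : nat := (\sum_i a i)%N.

Definition mi_incr (a : mindex) (i : 'I_s) : mindex :=
  fun j => (a j + (j == i))%N.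

Definition basis_vec (i : 'I_s) : E := delta_mx 0 i.

Definition partial (V : normedModType R) (i : 'I_s) (f : E -> V) : E -> V :=
  fun x => 'D_(basis_vec i) f x.

Definition mpartial (V : normedModType R) (a : mindex) (f : E -> V) : E -> V :=
  foldr (fun i g => iter (a i) (partial i) g) f (enum 'I_s).

Definition Cinfty (V : normedModType R) (f : E -> V) : Prop :=
  forall w : seq 'I_s, let g := foldr (@partial V) f w in
    continuous g /\ forall (i : 'I_s) (x : E), derivable g x (basis_vec i).

Definition monomial (a : mindex) (x : E) : R := \prod_i x 0 i ^+ a i.

End MultiIndices.

(* Integral over R^n, as an iterated Lebesgue integral; it is only applied to
   continuous compactly supported functions, for which Fubini's theorem makes
   it the Lebesgue integral. *)
Fixpoint iter_integral (R : realType) (n : nat) : ('rV[R]_n -> R) -> R :=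
  match n with
  | 0 => fun f => f 0
  | n'.+1 => fun f =>
      \int[lebesgue_measure]_x
        iter_integral (fun y : 'rV[R]_n' => f (row_mx (x%:M : 'rV_1) y))
  end.

Definition cintegral (R : realType) (n : nat) (f : 'rV[R]_n -> Rcomplex R) :
    Rcomplex R :=
  Complex (iter_integral (fun x => complex.Re (f x)))
          (iter_integral (fun x => complex.Im (f x))).

Section TestFunctions.
Variables (R : realType) (s : nat).
Local Notation E := 'rV[R]_s.
Local Notation C := (Rcomplex R).

Definition compact_in (K Omega : set E) : Prop := compact K /\ K `<=` Omega.

(* D(Omega), each test function being extended by 0 to R^s *)
Definition D (Omega : set E) : set (E -> C) :=
  [set phi | Cinfty phi /\
    exists2 K, compact_in K Omega & forall x, ~ K x -> phi x = 0].

(* The seminorms on D(Omega) that are continuous for the (LF) topology: the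
   finest locally convex topology making every inclusion D_K -> D(Omega)
   continuous, D_K carrying the seminorms of uniform convergence of all
   derivatives. The values of p outside D(Omega) play no role. Requiring
   complex rather than real homogeneity would define the same topology. *)
Definition D_seminorm (Omega : set E) (p : (E -> C) -> R) : Prop :=
  [/\ forall phi psi, D Omega phi -> D Omega psi ->
        p (phi + psi) <= p phi + p psi,
      forall (c : R) phi, D Omega phi -> p (c *: phi) = `|c| * p phi
    & forall K, compact_in K Omega -> exists (m : nat) (c : R),
        forall phi, D Omega phi -> (forall x, ~ K x -> phi x = 0) ->
        forall M : R,
          (forall a x, (mi_size a <= m)%N -> `|mpartial a phi x| <= M) ->
          p phi <= c * M].

Definition D_bounded (Omega : set E) (B : set (E -> C)) : Prop :=
  B `<=` D Omega /\
  forall p, D_seminorm Omega p -> exists M, forall phi, B phi -> p phi <= M.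

(* g is the derivative of f at x in direction v, as a limit in D(Omega) *)
Definition D_is_derive (Omega : set E) (V : normedModType R)
    (x v : V) (f : V -> E -> C) (g : E -> C) : Prop :=
  D Omega g /\
  forall p, D_seminorm Omega p ->
    p (h^-1 *: (f (x + h *: v) - f x) - g) @[h --> (0 : R)^'] --> (0 : R).

Definition smooth_curve (V : normedModType R) (A : set V) (c : R -> V) : Prop :=
  (forall t, A (c t)) /\ forall n t, derivable (derive1n n c) t 1.

Definition D_smooth_curve (Omega : set E) (A : set (E -> C))
    (c : R -> E -> C) : Prop :=
  (forall t, A (c t)) /\
  exists d : nat -> R -> E -> C,
    [/\ d 0%N = c,
        forall n t, D Omega (d n t)
      & forall n t, D_is_derive Omega (t : R^o) 1 (d n) (d n.+1 t)].

Definition A0 (Omega : set E) : set (E -> C) :=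
  [set phi | D Omega phi /\ cintegral phi = 1].

Definition moment (a : mindex s) (phi : E -> C) : C :=
  cintegral (fun xi => monomial a xi *: phi xi).

Definition Tinv (u : (E -> C) * E) : (E -> C) * E :=
  (fun xi => u.1 (xi + u.2), u.2).

(* F is a total function on pairs, but only its values on
   U(Omega) = Tinv (A0(Omega) x Omega) are constrained. *)
Definition basic_space (Omega : set E) (F : (E -> C) * E -> C) : Prop :=
  forall (c : R -> E -> C) (x : R -> E),
    D_smooth_curve Omega (A0 Omega) c -> smooth_curve Omega x ->
    smooth_curve setT (fun t => F (Tinv (c t, x t))).

Definition I01 : set R := [set e | 0 < e <= 1].

(* A curve into I x Omega, a subset of R x R^s, is smooth iff both of its
   components are. *)
Definition smooth_family (Omega : set E) (phi : R -> E -> E -> C) : Prop :=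
  (forall e x, I01 e -> Omega x -> A0 setT (phi e x)) /\
  forall (e : R -> R) (x : R -> E),
    smooth_curve (I01 : set R^o) e -> smooth_curve Omega x ->
    D_smooth_curve setT (A0 setT) (fun t => phi (e t) (x t)).

(* d a e x is the D(R^s)-valued derivative of order a, with respect to x, of
   phi at (e, x); such a d is unique on I x Omega. *)
Definition x_derivatives (Omega : set E) (phi : R -> E -> E -> C)
    (d : mindex s -> R -> E -> E -> C) : Prop :=
  forall e x, I01 e -> Omega x ->
    d (fun=> 0%N) e x = phi e x /\
    forall a i, D_is_derive setT x (basis_vec R i) (d a e)
                  (d (mi_incr a i) e x).

Definition test_object (Omega : set E) (phi : R -> E -> E -> C) : Prop :=
  smooth_family Omega phi /\
  exists2 d, x_derivatives Omega phi d &
    forall K a, compact_in K Omega ->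
      D_bounded setT [set psi | exists e x, [/\ I01 e, K x & psi = d a e x]].

(* sup_{x in K} |f e x| = O(g e) as e -> 0+ *)
Definition sup_bigO (K : set E) (f : R -> E -> C) (g : R -> R) : Prop :=
  exists c : R, \forall e \near 0^'+, forall x, K x -> `|f e x| <= c * g e.

Definition type_Ag (Omega : set E) (q : nat) (phi : R -> E -> E -> C) : Prop :=
  test_object Omega phi /\
  forall L a, compact_in L Omega -> (1 <= mi_size a <= q)%N ->
    sup_bigO L (fun e x => moment a (phi e x)) (fun e => e ^+ q).

Definition type_Ag_infty (Omega : set E) (q : nat)
    (phi : R -> E -> E -> C) : Prop :=
  test_object Omega phi /\
  exists2 d, x_derivatives Omega phi d &
    forall L b a, compact_in L Omega -> (1 <= mi_size a <= q)%N ->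
      sup_bigO L (fun e x => moment a (d b e x)) (fun e => e ^+ q).

Definition scaling (e : R) (phi : E -> C) : E -> C :=
  fun xi => e ^- s *: phi (e^-1 *: xi).

Definition moderate (X : nat -> (R -> E -> E -> C) -> Prop) (Omega : set E)
    (F : (E -> C) * E -> C) : Prop :=
  forall K a, compact_in K Omega -> exists2 N : nat, (0 < N)%N &
    forall phi, X N phi ->
      sup_bigO K
        (fun e => mpartial a (fun x => F (scaling e (phi e x), x)))
        (fun e => e ^- N).

Definition negligible_wrt (X : nat -> (R -> E -> E -> C) -> Prop)
    (Omega : set E) (F : (E -> C) * E -> C) : Prop :=
  forall K a (n : nat), compact_in K Omega -> (0 < n)%N ->
    exists2 q : nat, (0 < q)%N &
      forall phi, X q phi ->
        sup_bigO K
          (fun e => mpartial a (fun x => F (scaling e (phi e x), x)))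
          (fun e => e ^+ n).

End TestFunctions.

(* Main.v *)
Require Import Defs.
From mathcomp Require Import all_boot all_order all_algebra.
From mathcomp Require Import complex ring lra.
From mathcomp Require Import all_classical all_reals all_analysis.

Import numFieldNormedType.Exports.

(** The two types of test objects nearly coincide: for every q, a test object
    of type [A_g]_(q+1) is of type [A_g^infty]_q, and trivially one of type
    [A_g^infty]_q is of type [A_g]_q. Since moderateness and negligibility
    quantify over q, this shift of the index by one is harmless, whatever the
    functional F does.

    The inclusion is an interpolation inequality of Landau-Kolmogorov type. For
    a test object phi, the moment m(e, x) = <xi^a, phi(e, x)> is a smooth
    function of x, and all its x-derivatives <xi^a, d_x^b phi(e, x)> are
    bounded on compact sets, uniformly in e. If moreover m = O(e^(q+1)), then
    every derivative d_x^b m must be small as well: it is O(e^r) for each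
    r < q+1, in particular O(e^q).

    To differentiate and to bound moments one needs that |<xi^a, .>| is a
    continuous seminorm of D(R^s) ([pmoment_seminorm]), hence that the iterated
    integral is linear on continuous functions supported in a ball, with the
    obvious bound ([iter_integral_bounded_linear]). Then
    [pmoment_is_derive] says that moments commute with d_x.

    For the interpolation, fix b, put n = |b| + 1 and use eta = e^(1/n) as the
    step of finite differences. The k-th difference of a function g with
    step eta is eta^k g^(k)(xi) for some intermediate point xi, whence
       |g^(k)| <= 2^k eta^-k sup |g| + k eta sup |g^(k+1)|
    ([derivative_interpolation]). If g = O(eta^Q) and all derivatives of g are
    bounded, a descending induction on k, starting at k = Q, gives
    g^(k) = O(eta^(Q-k)); so one differentiation costs one power of eta
    ([directional_interpolation]), and d_x^b costs |b| < n of them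
    ([mixed_interpolation]). With Q = n (q+1) there remain more than n q
    powers of eta, that is O(e^q). *)

Set Implicit Arguments.
Unset Strict Implicit.
Unset Printing Implicit Defensive.

Import Order.TTheory GRing.Theory Num.Theory.

Local Open Scope classical_set_scope.
Local Open Scope ring_scope.

(** * The maximum norm on row vectors *)

Section RowVectorNorm.
Variable R : realType.

Lemma rV_entry_le n (v : 'rV[R]_n) j : `|v 0 j| <= `|v|.
Proof.
rewrite [leRHS]/Num.norm /= mx_normrE; apply/bigmax_geP; right => /=.
by exists (ord0, j).
Qed.

Lemma rV_norm_le n (v : 'rV[R]_n) M :
  0 <= M -> (forall j, `|v 0 j| <= M) -> `|v| <= M.
Proof.
move=> M0 vM; rewrite [leLHS]/Num.norm /= mx_normrE; apply/bigmax_leP; split => //=.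
by case=> i j _ /=; rewrite ord1.
Qed.

Lemma norm_cons n (a : R) (b : 'rV[R]_n) :
  `|row_mx (a%:M : 'rV_1) b| = Num.max `|a| `|b|.
Proof.
apply/eqP; rewrite eq_le; apply/andP; split.
  apply: rV_norm_le => [|j]; first by rewrite le_max normr_ge0.
  rewrite mxE; case: splitP => k _; rewrite ?ord1 ?mxE ?eqxx ?mulr1n le_max.
    by rewrite lexx.
  by rewrite rV_entry_le orbT.
rewrite ge_max; apply/andP; split.
  have := rV_entry_le (row_mx (a%:M : 'rV_1) b) (lshift n 0).
  by rewrite row_mxEl mxE eqxx mulr1n.
apply: rV_norm_le => // j.
have := rV_entry_le (row_mx (a%:M : 'rV_1) b) (rshift 1 j).
by rewrite row_mxEr.
Qed.

Lemma continuous_cons n (x : R) (y : 'rV[R]_n) :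
  (row_mx ((z.1)%:M : 'rV_1) z.2 : 'rV_(1 + n)) @[z --> (x, y)]
  --> (row_mx (x%:M : 'rV_1) y : 'rV_(1 + n)).
Proof.
apply/cvgrPdist_le => e e0.
near=> z.
rewrite opp_row_mx add_row_mx -raddfB /= norm_cons ge_max; apply/andP; split.
  near: z; apply: (@cvgr_dist_le _ _ _ _ _ (fun z : R * 'rV[R]_n => z.1)) => //.
  exact: cvg_fst.
near: z; apply: (@cvgr_dist_le _ _ _ _ _ (fun z : R * 'rV[R]_n => z.2)) => //.
exact: cvg_snd.
Unshelve. all: by end_near. Qed.

End RowVectorNorm.

(** * The iterated integral of continuous functions with bounded support *)

Section IteratedIntegral.
Variable R : realType.

Definition supported_in_ball n (M : R) (f : 'rV[R]_n -> R) :=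
  continuous f /\ forall x, M < `|x| -> f x = 0.

Lemma supported_section n M (f : 'rV[R]_n.+1 -> R) x :
  supported_in_ball M f ->
  supported_in_ball M (fun y : 'rV[R]_n => f (row_mx (x%:M : 'rV_1) y)).
Proof.
case=> fc f0; split => [y|y My]; last by rewrite f0// norm_cons lt_max My orbT.
apply: (@continuous_comp _ _ _ (fun y : 'rV[R]_n => row_mx (x%:M : 'rV_1) y) f);
  last exact: fc.
apply: (@continuous_comp _ _ _ (fun y : 'rV[R]_n => (x, y))
  (fun z => row_mx ((z.1)%:M : 'rV_1) z.2)); last exact: continuous_cons.
exact: (cvg_pair (cvg_cst x) (@cvg_id _ (nbhs y))).
Qed.

(** Uniform continuity in the first coordinate: outside the ball both sections
    vanish, and on its compact closure a covering argument makes the pointwise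
    estimate uniform in y. *)
Lemma sections_cvg_uniform n M (f : 'rV[R]_n.+1 -> R) x e :
  supported_in_ball M f -> 0 < e ->
  \forall x' \near x, forall y : 'rV[R]_n,
    `|f (row_mx (x%:M : 'rV_1) y) - f (row_mx (x'%:M : 'rV_1) y)| <= e.
Proof.
move=> [fc f0] e0.
have Kc : compact [set y : 'rV[R]_n | `|y| <= M].
  apply: bounded_closed_compact.
    exists M; split; first exact: num_real.
    by move=> r Mr y /= /le_trans; apply; exact: ltW.
  apply: (@preimage_closed _ _ (fun y : 'rV[R]_n => `|y|) [set r | r <= M]).
    by move=> z _; exact: norm_continuous.
  exact: closed_le.
have key (y : 'rV[R]_n) : `|y| <= M -> \forall y' \near y & x' \near x,
    `|f (row_mx (x%:M : 'rV_1) y') - f (row_mx (x'%:M : 'rV_1) y')| <= e.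
  move=> _.
  have fxy : f (row_mx ((z.1)%:M : 'rV_1) z.2) @[z --> (x, y)]
      --> f (row_mx (x%:M : 'rV_1) y).
    exact: (cvg_comp _ _ (@continuous_cons _ _ x y) (fc _)).
  have /cvgrPdist_le /(_ _ (divr_gt0 e0 (@ltr0n R 2))) := fxy.
  case=> -[U V] /= [Ux Vy] UV; exists (V, U) => //= -[y' x'] /= [Vy' Ux'].
  rewrite [e]splitr -(subrKA (f (row_mx (x%:M : 'rV_1) y))).
  apply: le_trans (ler_normD _ _) _; apply: lerD.
    rewrite distrC; apply: (UV (x, y')); split => //; exact: nbhs_singleton.
  exact: (UV (x', y')).
have := (compact_near_coveringP _).1 Kc _ (nbhs x)
  (fun x' y => `|f (row_mx (x%:M : 'rV_1) y) - f (row_mx (x'%:M : 'rV_1) y)| <= e)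
  (nbhs_filter _) key.
apply: filterS => x' fx' y; have [yM|My] := leP `|y| M; first exact: fx'.
by rewrite !f0 ?subrr ?normr0 ?(ltW e0)// norm_cons lt_max My orbT.
Qed.

Lemma supported_integrable M (h : R -> R) :
  continuous h -> (forall x, M < `|x| -> h x = 0) ->
  h = h \_ `[- M, M] /\
  lebesgue_measure.-integrable setT (EFin \o h).
Proof.
move=> hc h0.
have E : h = h \_ `[- M, M].
  apply/funext => x; rewrite patchE; case: ifPn => // /negP xM.
  rewrite h0// ltNge; apply/negP => xM'; apply: xM; rewrite inE /=.
  by rewrite in_itv /= -ler_norml.
split => //.
rewrite E; have -> : EFin \o (h \_ `[- M, M]) = (EFin \o h) \_ `[- M, M].
  by rewrite restrict_EFin.
rewrite -integrable_mkcond//.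
apply: continuous_compact_integrable; first exact: segment_compact.
exact: continuous_subspaceT.
Qed.

(** Both claims must be proved in the same induction on the dimension: the
    integrand x |-> F f x of the outer integral is integrable because it is
    continuous, and its continuity is the bound in dimension n, applied by
    linearity to the difference of two sections. *)
Lemma iter_integral_bounded_linear n (M : R) : 0 <= M ->
  (forall (f : 'rV[R]_n -> R) B, supported_in_ball M f ->
     (forall x, `|f x| <= B) -> `|iter_integral f| <= (2 * M) ^+ n * B) /\
  (forall c (f g : 'rV[R]_n -> R), supported_in_ball M f ->
     supported_in_ball M g ->
     iter_integral (fun x => c * f x + g x) =
     c * iter_integral f + iter_integral g).
Proof.
move=> M0; elim: n => [|n [IHb IHl]].
  by split => [f B _ fB|//]; rewrite expr0 mul1r; exact: fB.
pose F f (x : R) := iter_integral (fun y : 'rV[R]_n => f (row_mx (x%:M : 'rV_1) y)).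
have Fb f x B : supported_in_ball M f -> (forall x, `|f x| <= B) ->
    `|F f x| <= (2 * M) ^+ n * B.
  by move=> fM fB; apply: IHb => [|y]; [exact: supported_section | exact: fB].
have F0 f x : supported_in_ball M f -> M < `|x| -> F f x = 0.
  move=> fM Mx; have := IHb _ 0 (supported_section x fM).
  rewrite mulr0 => Fx; apply/eqP; rewrite -normr_le0; apply: Fx => y.
  by rewrite fM.2 ?normr0// norm_cons lt_max Mx.
have FB f : supported_in_ball M f -> continuous (F f).
  move=> fM x; apply/cvgrPdist_le => e e0.
  pose c := (2 * M) ^+ n + 1.
  have c0 : 0 < c by rewrite ltr_wpDl// exprn_ge0// mulr_ge0.
  near=> x'.
  have -> : F f x - F f x' = iter_integral (fun y : 'rV[R]_n =>
      -1 * f (row_mx (x'%:M : 'rV_1) y) + f (row_mx (x%:M : 'rV_1) y)).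
    by rewrite IHl ?mulN1r 1?addrC//; exact: supported_section.
  have : forall y, `|-1 * f (row_mx (x'%:M : 'rV_1) y) +
      f (row_mx (x%:M : 'rV_1) y)| <= e / c.
    move=> y; rewrite mulN1r addrC; move: y.
    near: x'; exact: (sections_cvg_uniform _ fM (divr_gt0 e0 c0)).
  move=> /IHb /le_trans; apply; last first.
    rewrite mulrA ler_pdivrMr// mulrC ler_pM2l// lerDl//.
  have [f1c f10] := supported_section x' fM.
  have [f2c f20] := supported_section x fM.
  split => [y|y My]; last by rewrite f10// f20// mulr0 addr0.
  exact: (cvgD (cvgM (cvg_cst _) (f1c y)) (f2c y)).
have FI f : supported_in_ball M f ->
    F f = F f \_ `[- M, M] /\ lebesgue_measure.-integrable setT (EFin \o F f).
  move=> fM; apply: supported_integrable; first exact: FB.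
  by move=> x; exact: F0.
split => [f B fM fB|c f g fM gM].
  have -> : iter_integral f = Rintegral lebesgue_measure setT (F f) by [].
  have [E I] := FI f fM.
  rewrite E -Rintegral_mkcond.
  have IS : lebesgue_measure.-integrable `[- M, M] (EFin \o F f).
    by apply: integrableS I => //.
  apply: le_trans (le_normr_Rintegral _ IS) _ => //.
  apply: (@le_trans _ _
    (\int[lebesgue_measure]_(x in `[- M, M]) ((2 * M) ^+ n * B))%R).
    apply: le_Rintegral => //.
    - by rewrite -[EFin \o _]/(abse \o (EFin \o F f)); exact: integrable_abse.
    - apply: continuous_compact_integrable; first exact: segment_compact.
      by apply: continuous_subspaceT => x; exact: cvg_cst.
    - by move=> x _; exact: Fb.
  rewrite Rintegral_cst//= lebesgue_measure_itv/= lte_fin.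
  have B0 : 0 <= B by apply: le_trans (fB 0).
  case: ltP => MM /=; rewrite ?opprK.
    by rewrite le_eqVlt; apply/orP; left; apply/eqP; rewrite exprS; ring.
  by rewrite mulr0 mulr_ge0// exprn_ge0// mulr_ge0.
have IE h : iter_integral h = Rintegral lebesgue_measure setT (F h) by [].
rewrite !IE; have -> : F (fun x => c * f x + g x) = (fun x => c * F f x + F g x).
  by apply/funext => x; rewrite /F IHl//; exact: supported_section.
rewrite RintegralD//;
  [|exact: (integrableZl measurableT c (FI f fM).2)|exact: (FI g gM).2].
by rewrite RintegralZl//; exact: (FI f fM).2.
Unshelve. all: by end_near. Qed.

End IteratedIntegral.

(** * Moments as continuous seminorms on test functions *)

Section MomentSeminorms.
Variables (R : realType) (s : nat).
Local Notation E := 'rV[R]_s.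
Local Notation C := (Rcomplex R).

Lemma compact_norm_bounded (V : normedModType R) (K : set V) :
  compact K -> exists2 M : R, 0 <= M & forall x, K x -> `|x| <= M.
Proof.
move=> /compact_bounded[M [_ KM]]; exists (`|M| + 1); first exact: addr_ge0.
by move=> x Kx; apply: KM => //; rewrite (le_lt_trans (ler_norm M))// ltrDl.
Qed.

Lemma monomial_continuous (a : mindex s) : continuous (monomial a : E -> R).
Proof.
rewrite /monomial => x; elim: (index_enum _) => [|i r IH].
  rewrite (_ : (fun _ => _) = fun=> 1); first exact: cst_continuous.
  by apply/funext => y; rewrite big_nil.
rewrite (_ : (fun y : E => _) =
    fun y : E => y 0 i ^+ a i * \prod_(j <- r) y 0 j ^+ a j); last first.
  by apply/funext => y; rewrite big_cons.
apply: cvgM IH.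
exact: (cvg_comp _ _ (@coord_continuous R 1 s 0 i x) (@exprn_continuous _ (a i) _)).
Qed.

Lemma monomial_bounded (a : mindex s) (M : R) (x : E) :
  `|x| <= M -> `|monomial a x| <= \prod_i M ^+ a i.
Proof.
move=> xM; rewrite normr_prod; apply: ler_prod => i _.
rewrite normr_ge0 normrX lerXn2r ?nnegrE//.
  exact: le_trans xM.
exact: le_trans (rV_entry_le _ _) xM.
Qed.

Lemma mpartial0 (V : normedModType R) (f : E -> V) : mpartial (fun=> 0%N) f = f.
Proof. by rewrite /mpartial; elim: (enum _) => //= i r ->. Qed.

Lemma mi_size0 : mi_size (fun _ : 'I_s => 0%N) = 0%N.
Proof. by rewrite /mi_size big1. Qed.

(* [pr] stands for the real or the imaginary part. *)
Variable pr : C -> R.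
Hypothesis pr_linear : forall (c : R) z w, pr (c *: z + w) = c * pr z + pr w.
Hypothesis pr_le : forall z, `|pr z| <= `|z|.

Definition pmoment (a : mindex s) (phi : E -> C) : R :=
  iter_integral (fun x => pr (monomial a x *: phi x)).

Lemma prZ c z : pr (c *: z) = c * pr z.
Proof.
have pr0 : pr 0 = 0 by apply/eqP; rewrite -normr_le0 -(normr0 C).
by rewrite -[c *: z]addr0 pr_linear pr0 addr0.
Qed.

Lemma pr_continuous : continuous pr.
Proof.
move=> z; apply/(@cvgrPdist_le _ _ _ _ (nbhs_filter z)) => e e0; near=> w.
have -> : pr z - pr w = pr (z - w).
  by rewrite addrC -mulN1r -pr_linear scaleN1r addrC.
apply: le_trans (pr_le _) _.
by near: w; apply: cvgr_dist_le => //; exact: cvg_id.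
Unshelve. all: by end_near. Qed.

Lemma integrand_supported (a : mindex s) (phi : E -> C) M :
  continuous phi -> (forall x, M < `|x| -> phi x = 0) ->
  supported_in_ball M (fun x => pr (monomial a x *: phi x)).
Proof.
move=> phic phi0; split => [x|x Mx]; last first.
  by rewrite prZ phi0// -(scale0r 0) prZ mul0r mulr0.
rewrite (_ : (fun _ => _) = fun x => monomial a x * pr (phi x)); last first.
  by apply/funext => y; rewrite prZ.
have prphi : pr (phi y) @[y --> x] --> pr (phi x).
  exact: (cvg_comp _ _ (phic x) (@pr_continuous _)).
exact: (cvgM (@monomial_continuous a x) prphi).
Qed.

(** D(R^s) enters only through continuity and bounded support; this larger class
    is visibly closed under linear combinations. *)
Definition Cc (phi : E -> C) :=
  continuous phi /\ exists2 M : R, 0 <= M & forall x, M < `|x| -> phi x = 0.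

Lemma Cc_linear (c : R) phi psi : Cc phi -> Cc psi -> Cc (c *: phi + psi).
Proof.
move=> [phic [M M0 phi0]] [psic [N N0 psi0]]; split => [x|].
  exact: (cvgD (cvgZ (cvg_cst c) (phic x)) (psic x)).
exists (Num.max M N) => [|x]; first by rewrite le_max M0.
rewrite gt_max => /andP[Mx Nx].
have E0 : c *: (0 : C) + 0 = 0 by rewrite scaler0 addr0.
have EE : (c *: phi + psi) x = c *: phi x + psi x by [].
by rewrite EE phi0// psi0.
Qed.

Lemma D_Cc (phi : E -> C) : D setT phi -> Cc phi.
Proof.
case=> phiC [K [Kc _] phi0]; split; first exact: (phiC [::]).1.
have [M M0 KM] := compact_norm_bounded Kc; exists M => // x Mx.
by apply: phi0 => /KM; rewrite leNgt Mx.
Qed.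

Lemma pmoment_linear (a : mindex s) (c : R) phi psi : Cc phi -> Cc psi ->
  pmoment a (c *: phi + psi) = c * pmoment a phi + pmoment a psi.
Proof.
move=> [phic [M M0 phi0]] [psic [N N0 psi0]].
rewrite /pmoment -(iter_integral_bounded_linear s (_ : 0 <= Num.max M N)).2.
- congr iter_integral; apply/funext => x; rewrite !prZ.
  by rewrite [(c *: phi + psi) x]/(c *: phi x + psi x) pr_linear; ring.
- by rewrite le_max M0.
- by apply: integrand_supported => // x; rewrite gt_max => /andP[/phi0].
- by apply: integrand_supported => // x; rewrite gt_max => /andP[_ /psi0].
Qed.

Lemma Cc0 : Cc 0.
Proof. by split; [exact: (@cst_continuous _ _ (0 : C)) | exists 0]. Qed.

Lemma pmomentZ (a : mindex s) (c : R) phi : Cc phi ->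
  pmoment a (c *: phi) = c * pmoment a phi.
Proof.
have pm0 : pmoment a 0 = 0.
  have := pmoment_linear a 1 Cc0 Cc0.
  by rewrite scaler0 addr0 mul1r => /eqP; rewrite -subr_eq subrr => /eqP.
by move=> phiC; rewrite -[c *: phi]addr0 pmoment_linear ?pm0 ?addr0//; exact: Cc0.
Qed.

Lemma pmoment_bounded (a : mindex s) (K : set E) : compact K ->
  exists c : R, forall phi, D setT phi -> (forall x, ~ K x -> phi x = 0) ->
    forall B, (forall x, `|phi x| <= B) -> `|pmoment a phi| <= c * B.
Proof.
move=> Kc; have [M M0 KM] := compact_norm_bounded Kc.
exists ((2 * M) ^+ s * \prod_i M ^+ a i) => phi Dphi phi0 B phiB; rewrite -mulrA.
have phiM x : M < `|x| -> phi x = 0.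
  by move=> Mx; apply: phi0 => /KM; rewrite leNgt Mx.
apply: (iter_integral_bounded_linear s M0).1.
  by apply: integrand_supported => //; have [] := D_Cc Dphi.
move=> x; rewrite prZ normrM; have [xM|Mx] := leP `|x| M.
  apply: ler_pM => //; first exact: monomial_bounded.
  exact: le_trans (pr_le _) _.
rewrite phiM//; have := pr_le 0; rewrite normr0 normr_le0 => /eqP ->.
rewrite normr0 mulr0; apply: mulr_ge0; last exact: le_trans (phiB 0).
by apply: prodr_ge0 => i _; rewrite exprn_ge0.
Qed.

(** Since a moment is controlled by the supremum of the test function on each
    fixed compact support, the order of derivatives needed is 0. *)
Lemma pmoment_seminorm (a : mindex s) :
  D_seminorm setT (fun phi => `|pmoment a phi|).
Proof.
split => [phi psi Dphi Dpsi|c phi Dphi|K [Kc _]].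
- rewrite -[phi]scale1r pmoment_linear ?mul1r ?scale1r; [|exact: D_Cc..].
  exact: ler_normD.
- by rewrite pmomentZ ?normrM//; exact: D_Cc.
- have [c pc] := pmoment_bounded a Kc.
  exists 0%N, c => phi Dphi phi0 M phiM; apply: pc => // x.
  by rewrite -[phi]mpartial0; apply: phiM; rewrite mi_size0.
Qed.

(** The seminorm |pmoment a| measures the convergence of the difference quotients
    in D(R^s), and by linearity the moment of a difference quotient is the
    difference quotient of the moments. *)
Lemma pmoment_is_derive (Omega : set E) (f : E -> E -> C) (g : E -> C)
    (x v : E) (a : mindex s) : open Omega -> Omega x ->
  (forall y, Omega y -> D setT (f y)) -> D_is_derive setT x v f g ->
  is_derive x v (fun y => pmoment a (f y)) (pmoment a g).
Proof.
move=> Oo Ox fD [gD /(_ _ (pmoment_seminorm a)) fg].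
suff H : h^-1 *: (pmoment a (f (h *: v + x)) - pmoment a (f x)) @[h --> 0^']
    --> pmoment a g.
  have dv : derivable (fun y => pmoment a (f y)) x v.
    by apply/cvg_ex; exists (pmoment a g).
  by apply: DeriveDef => //; exact: cvg_lim H.
apply/cvgrPdist_le => e e0.
have /cvgrPdist_le /(_ _ e0) := fg.
have Oh : \forall h \near 0^', Omega (x + h *: v).
  apply: nbhs_dnbhs.
  have : x + h *: v @[h --> 0] --> x.
    rewrite -[X in _ --> X]addr0 -(scale0r v); apply: cvgD; first exact: cvg_cst.
    by apply: cvgZ; [exact: cvg_id | exact: cvg_cst].
  by apply; apply: open_nbhs_nbhs.
move: Oh; apply: filterS2 => h Oh; rewrite sub0r normrN normr_id.
have -> : h^-1 *: (f (x + h *: v) - f x) - g =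
    h^-1 *: f (x + h *: v) + ((- h^-1) *: f x + (-1) *: g).
  by rewrite scalerBr scaleNr scaleN1r addrA.
have cf := D_Cc (fD _ Oh); have cx := D_Cc (fD _ Ox); have cg := D_Cc gD.
have cN : Cc (-1 *: g) by rewrite -[_ *: g]addr0; exact: (Cc_linear _ cg Cc0).
have cxN : Cc (- h^-1 *: f x + -1 *: g) by exact: Cc_linear.
rewrite pmoment_linear// pmoment_linear// pmomentZ//.
rewrite distrC [h *: v + x]addrC.
by rewrite [_ *: (_ - _)]mulrBr mulNr mulN1r addrA.
Qed.

End MomentSeminorms.

(** * Finite differences in one variable *)

Section FiniteDifferences.
Variable R : realType.
Implicit Types (h a : R) (u : R -> R) (g : nat -> R -> R).

Fixpoint fdiff h k u a : R :=
  if k is k'.+1 then fdiff h k' (fun t => u (t + h) - u t) a else u a.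

Lemma fdiff_bound h k u a A : 0 <= h ->
  (forall t, a <= t <= a + h *+ k -> `|u t| <= A) ->
  `|fdiff h k u a| <= A *+ (2 ^ k).
Proof.
move=> h0; elim: k u A => [|k IH] u A uA /=.
  by rewrite expn0 mulr1n; apply: uA; rewrite mulr0n addr0 lexx.
rewrite expnS mulrnA; apply: IH => t /andP[at_ ta]; rewrite mulr2n.
apply: le_trans (ler_normB _ _) _; apply: lerD; apply: uA.
  by rewrite mulrSr addrA lerD// andbT; apply: le_trans at_ _; rewrite lerDl.
by rewrite at_ (le_trans ta)// lerD// mulrSr lerDl.
Qed.

(** By induction applied to t |-> g j (t + h) - g j t, the difference is
    h^k times an increment of g k, to which the mean value theorem applies. *)
Lemma fdiff_mean_value h k g a : 0 < h ->
  (forall j t, a <= t <= a + h *+ k -> is_derive t (1 : R) (g j) (g j.+1 t)) ->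
  exists2 xi, a <= xi <= a + h *+ k & fdiff h k (g 0%N) a = h ^+ k * g k xi.
Proof.
move=> h0; elim: k g => [|k IH] g dg /=.
  by exists a; rewrite ?expr0 ?mul1r// mulr0n addr0 lexx.
have [|xi /andP[ax xa] ->] := IH (fun j t => g j (t + h) - g j t).
  move=> j t /andP[at_ ta].
  have d1 : is_derive (t + h) (1 : R) (g j) (g j.+1 (t + h)).
    by apply: dg; rewrite mulrSr addrA lerD// andbT (le_trans at_)// lerDl ltW.
  have d2 : is_derive t (1 : R) (g j) (g j.+1 t).
    by apply: dg; rewrite at_ (le_trans ta)// lerD// mulrSr lerDl ltW.
  have d3 : is_derive t (1 : R) (fun t => t + h) 1.
    by rewrite -[X in is_derive _ _ _ X]addr0; apply: is_deriveD.
  have d4 := @is_derive1_comp _ (g j) (fun t => t + h) t _ _ d1 d3.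
  rewrite mulr1 in d4; exact: is_deriveB.
have xih : xi < xi + h by rewrite ltrDl.
have sub t : xi <= t <= xi + h -> a <= t <= a + h *+ k.+1.
  move=> /andP[xt tx]; rewrite (le_trans ax xt) (le_trans tx)//.
  by rewrite mulrSr addrA lerD.
have [c| |c cI E] := @MVT R (g k) (g k.+1) xi (xi + h) xih.
- by rewrite in_itv /= => /andP[/ltW c1 /ltW c2]; apply: dg; apply: sub; rewrite c1.
- apply: continuous_in_subspaceT => c; rewrite inE /= in_itv /= => cI.
  apply: differentiable_continuous; apply/derivable1_diffP.
  by have [] := dg k c (sub _ cI).
exists c; last by rewrite E addrAC subrr add0r exprSr; ring.
by move: cI; rewrite in_itv /= => /andP[/ltW c1 /ltW c2]; apply: sub; rewrite c1.
Qed.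

(** The point where the mean value theorem for differences computes g k is at
    distance at most k h from a, so g k a differs from that value by at most
    k h B. Multiplying by h^k avoids a division. *)
Lemma derivative_interpolation h k g a A B : 0 < h ->
  (forall j t, a <= t <= a + h *+ k -> is_derive t (1 : R) (g j) (g j.+1 t)) ->
  (forall t, a <= t <= a + h *+ k -> `|g 0%N t| <= A) ->
  (forall t, a <= t <= a + h *+ k -> `|g k.+1 t| <= B) ->
  h ^+ k * `|g k a| <= A *+ (2 ^ k) + B * (h ^+ k.+1 *+ k).
Proof.
move=> h0 dg gA gB.
have [xi /andP[ax xa] E] := fdiff_mean_value h0 dg.
have hk0 : 0 <= h ^+ k by rewrite exprn_ge0// ltW.
have sub t : a <= t <= xi -> a <= t <= a + h *+ k.
  by move=> /andP[-> /le_trans]; apply.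
have [c| |c cI E2] := @MVT_segment R (g k) (g k.+1) a xi ax.
- by rewrite in_itv /= => /andP[/ltW c1 /ltW c2]; apply: dg; apply: sub; rewrite c1.
- apply: continuous_in_subspaceT => c; rewrite inE /= in_itv /= => cI.
  apply: differentiable_continuous; apply/derivable1_diffP.
  by have [] := dg k c (sub _ cI).
rewrite in_itv /= in cI.
have -> : g k a = g k xi - g k.+1 c * (xi - a) by rewrite -E2 subKr.
rewrite -{1}(ger0_norm hk0) -normrM mulrBr -E.
apply: le_trans (ler_normB _ _) _; apply: lerD.
  by apply: fdiff_bound gA; exact: ltW.
rewrite normrM ger0_norm// normrM (ger0_norm (_ : 0 <= xi - a)) ?subr_ge0//.
have -> : B * (h ^+ k.+1 *+ k) = h ^+ k * (B * (h *+ k)).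
  by rewrite exprS -mulrnAl; ring.
apply: ler_wpM2l => //; apply: ler_pM => //; first by rewrite subr_ge0.
  by apply: gB; exact: sub.
by rewrite lerBlDl.
Qed.

End FiniteDifferences.

(** * Interpolation of derivatives on compact sets *)

Section MultiIndexInduction.
Variable s : nat.
Implicit Types b : mindex s.

Lemma mi_size_incr b i : mi_size (mi_incr b i) = (mi_size b).+1.
Proof.
rewrite /mi_size /mi_incr big_split /= -[RHS]addn1; congr addn.
by rewrite (bigD1 i)//= eqxx big1 ?addn0// => j /negPf ->.
Qed.

Lemma mi_sizeS b m : mi_size b = m.+1 ->
  exists i b', b = mi_incr b' i /\ mi_size b' = m.
Proof.
move=> bm; have [i bi] : exists i, (0 < b i)%N.
  apply: contrapT => /forallNP b0; move: bm; rewrite /mi_size big1// => i _.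
  by apply/eqP; rewrite -leqn0 leqNgt; apply/negP/b0.
have bE : b = mi_incr (fun j => (b j - (j == i))%N) i.
  apply/funext => j; rewrite /mi_incr.
  by case: eqP => [->|_]; rewrite ?subnK// subn0 addn0.
exists i, (fun j => (b j - (j == i))%N); split => //.
by apply: succn_inj; rewrite -bm {2}bE mi_size_incr.
Qed.

Lemma mi_size_eq0 b : mi_size b = 0%N -> b = fun=> 0%N.
Proof.
move=> /eqP; rewrite /mi_size sum_nat_eq0 => /forallP b0.
by apply/funext => i; apply/eqP; exact: (implyP (b0 i)).
Qed.

End MultiIndexInduction.

Section Interpolation.
Variables (R : realType) (s : nat) (Omega : set 'rV[R]_s).
Hypothesis Omega_open : open Omega.
Local Notation E := 'rV[R]_s.

Lemma is_derive_line (u : E -> R) (x v : E) (t l : R) :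
  is_derive (x + t *: v) v u l -> is_derive t 1 (fun r => u (x + r *: v)) l.
Proof.
case=> du ul.
have Q : (fun h : R => h^-1 *: (((fun r => u (x + r *: v)) \o shift t) (h *: 1) -
             u (x + t *: v))) =
         (fun h : R => h^-1 *: ((u \o shift (x + t *: v)) (h *: v) -
             u (x + t *: v))).
  apply/funext => h /=; rewrite [h *: 1]mulr1 scalerDl.
  by rewrite addrCA.
by apply: DeriveDef; [rewrite /derivable Q | rewrite /derive Q].
Qed.

(** Room for finite differences: segments of a common length starting in K
    sweep out a compact set that still lies in Omega, so estimates on compact
    sets are available along them. *)
Lemma compact_segments (K : set E) (v : E) : compact_in K Omega ->
  exists2 r : R, 0 < r & exists2 K', compact_in K' Omega &
    forall x t, K x -> 0 <= t <= r -> K' (x + t *: v).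
Proof.
move=> [Kc KO].
have cont (x : E) : z.1 + z.2 *: v @[z --> (x, 0 : R)] --> x.
  rewrite -[X in _ --> X]addr0 -(scale0r v).
  by apply: cvgD; [exact: cvg_fst | apply: cvgZr_tmp; exact: cvg_snd].
have near0 : \forall t \near (0 : R), K `<=` (fun x => Omega (x + t *: v)).
  apply: ((compact_near_coveringP K).1 Kc R (nbhs (0 : R))
    (fun t x => Omega (x + t *: v)) (nbhs_filter _)) => x Kx.
  by apply: (cont x); apply: open_nbhs_nbhs; split => //; exact: KO.
have [r r0 rO] := (nbhs_ballP _ _).1 near0.
exists (r / 2); first by rewrite divr_gt0.
exists [set z.1 + z.2 *: v | z in K `*` `[0, r / 2]].
  split.
    apply: continuous_compact; last first.
      by apply: compact_setX => //; exact: segment_compact.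
    apply: continuous_subspaceT => -[y t].
    by apply: cvgD; [exact: cvg_fst | apply: cvgZr_tmp; exact: cvg_snd].
  move=> _ [[y t] /= [Ky]] + <-; rewrite in_itv /= => /andP[t0 tr].
  apply: (rO t) => //; rewrite /ball /= sub0r normrN ger0_norm//.
  by rewrite (le_lt_trans tr)// ltr_pdivrMr// ltr_pMr// ltr1n.
by move=> x t Kx tr; exists (x, t) => //; split => //=; rewrite in_itv.
Qed.

Definition unif_bigO (f : R -> E -> R) (g : R -> R) :=
  forall K, compact_in K Omega ->
    exists c, \forall e \near 0^'+, forall x, K x -> `|f e x| <= c * g e.

Variable eta : R -> R.
Hypothesis eta_gt0 : forall e, 0 < e -> 0 < eta e.
Hypothesis eta_small : forall r, 0 < r -> \forall e \near 0^'+, eta e <= r.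

(** Differentiating costs one power of eta, however large q is, because all
    higher derivatives are bounded: going down from V q = O(1), the inequality
    [derivative_interpolation] with step eta gives V (q - j) = O(eta^j) for all
    j <= q. The compact set must grow at each step, so the estimate is proved
    on all compact sets at once. *)
Lemma directional_interpolation (v : E) (V : nat -> R -> E -> R) (q : nat) :
  (forall k e x, I01 e -> Omega x -> is_derive x v (V k e) (V k.+1 e x)) ->
  (forall k, unif_bigO (V k) (fun=> 1)) ->
  unif_bigO (V 0%N) (fun e => eta e ^+ q) ->
  unif_bigO (V 1%N) (fun e => eta e ^+ q.-1).
Proof.
move=> dV bV V0.
suff : forall j, (j <= q)%N -> unif_bigO (V (q - j)%N) (fun e => eta e ^+ j).
  case: q V0 => [|q] V0 H; first exact: bV.
  by have := H q (leqnSn q); rewrite subSnn.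
elim=> [_|j IH jq]; first by rewrite subn0; exact: bV.
set k := (q - j.+1)%N.
have kE : (q - j)%N = k.+1 by rewrite /k -subSn// subSS.
have qE : q = (k + j.+1)%N by rewrite subnK.
move: (IH (ltnW jq)); rewrite kE => {}IH K Kc.
have [r r0 [K' K'c KK']] := compact_segments v Kc.
have [c0 Vc0] := V0 _ K'c.
have [c1 Vc1] := IH _ K'c.
exists (c0 *+ (2 ^ k) + c1 *+ k).
near=> e; move=> x Kx.
have e0 : 0 < e by near: e; exact: nbhs_right_gt.
have e1 : I01 e.
  by rewrite /I01 /= e0; near: e; exact: nbhs_right_le.
have h0 := eta_gt0 e0.
have hk0 : 0 < eta e ^+ k by rewrite exprn_gt0.
(* The k steps of length eta stay within the length r of the segments. *)
have seg t : 0 <= t <= 0 + eta e *+ k -> K' (x + t *: v).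
  rewrite add0r => /andP[t0 te]; apply: KK' => //; rewrite t0 (le_trans te)//.
  apply: (@le_trans _ _ ((r / k.+1%:R) *+ k)).
    rewrite lerMn2r; apply/orP; right.
    by near: e; apply: eta_small; rewrite divr_gt0.
  rewrite -mulr_natr mulrAC ler_pdivrMr// ler_wpM2l// ?ler_nat//.
  exact: ltW.
rewrite -(ler_pM2l hk0).
have := @derivative_interpolation R (eta e) k (fun j t => V j e (x + t *: v)) 0
  (c0 * eta e ^+ q) (c1 * eta e ^+ j) h0.
rewrite scale0r addr0 => interp; apply: le_trans (interp _ _ _) _.
- move=> i t ti; apply: is_derive_line; apply: dV => //.
  by apply: K'c.2; exact: seg.
- by move=> t /seg; move: (x + t *: v); near: e; exact: Vc0.
- by move=> t /seg; move: (x + t *: v); near: e; exact: Vc1.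
- rewrite qE !exprD !exprS -mulr_natr -[_ *+ k]mulr_natr -[_ *+ k]mulr_natr.
  by rewrite -[c0 *+ _]mulr_natr; lra.
Unshelve. all: by end_near. Qed.


Lemma mixed_interpolation (U : mindex s -> R -> E -> R) (q : nat) :
  (forall b i e x, I01 e -> Omega x ->
    is_derive x (basis_vec R i) (U b e) (U (mi_incr b i) e x)) ->
  (forall b, unif_bigO (U b) (fun=> 1)) ->
  unif_bigO (U (fun=> 0%N)) (fun e => eta e ^+ q) ->
  forall b, unif_bigO (U b) (fun e => eta e ^+ (q - mi_size b)).
Proof.
move=> dU bU U0 b; move: {2}(mi_size b) (erefl (mi_size b)) => m.
elim: m b => [|m IH] b bm; first by rewrite bm subn0 (mi_size_eq0 bm).
have [i [b' [-> b'm]]] := mi_sizeS bm; rewrite mi_size_incr subnS.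
apply: (@directional_interpolation
  (basis_vec R i) (fun k => U (iter k (fun c => mi_incr c i) b'))
  (q - mi_size b')%N).
- by move=> k; exact: bU.
- exact: IH.
Qed.

End Interpolation.

(** * Comparison of the two types of test objects *)

Section Comparison.
Variables (R : realType) (s : nat) (Omega : set 'rV[R]_s).
Hypothesis Omega_open : open Omega.
Local Notation E := 'rV[R]_s.
Local Notation C := (Rcomplex R).

Lemma Re_linear (c : R) (z w : C) :
  complex.Re (c *: z + w) = c * complex.Re z + complex.Re w.
Proof. by case: z w => [a b] [a' b']. Qed.

Lemma Im_linear (c : R) (z w : C) :
  complex.Im (c *: z + w) = c * complex.Im z + complex.Im w.
Proof. by case: z w => [a b] [a' b']. Qed.

Lemma Re_le (z : C) : `|complex.Re z| <= `|z|.
Proof.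
case: z => a b; rewrite -[leRHS]/(Normc.normc _) /= -sqrtr_sqr ler_wsqrtr//.
by rewrite lerDl sqr_ge0.
Qed.

Lemma Im_le (z : C) : `|complex.Im z| <= `|z|.
Proof.
case: z => a b; rewrite -[leRHS]/(Normc.normc _) /= -sqrtr_sqr ler_wsqrtr//.
by rewrite lerDr sqr_ge0.
Qed.

Lemma norm_le_ReIm (z : C) : `|z| <= `|complex.Re z| + `|complex.Im z|.
Proof.
case: z => a b; rewrite -[leLHS]/(Normc.normc _) /=.
rewrite -[leRHS]ger0_norm ?addr_ge0// -sqrtr_sqr ler_wsqrtr//.
rewrite sqrrD !real_normK ?num_real// -addrA lerD2l lerDr.
by rewrite mulrn_wge0// mulr_ge0.
Qed.

Lemma rootK (n : nat) (e : R) : 0 < e -> (e `^ (n.+1%:R)^-1) ^+ n.+1 = e.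
Proof.
move=> e0; rewrite -powR_mulrn ?powR_ge0// -powRrM mulVf ?pnatr_eq0//.
by rewrite powRr1// ltW.
Qed.

Lemma root_cvg0 (n : nat) (r : R) : 0 < r ->
  \forall e \near 0^'+, e `^ (n.+1%:R)^-1 <= r.
Proof.
move=> r0; near=> e; have e0 : 0 < e by near: e; exact: nbhs_right_gt.
rewrite -(@ler_pXn2r _ n.+1) ?nnegrE ?powR_ge0 ?(ltW r0)//.
rewrite rootK//.
by near: e; apply: nbhs_right_le; rewrite exprn_gt0.
Unshelve. all: by end_near. Qed.

(** The step eta = e^(1/(n+1)) with n = |b| is so fine that the n powers of eta
    lost by differentiating do not amount to one power of e. *)
Lemma pmoment_interpolation (pr : C -> R) (phi : R -> E -> E -> C)
    (d : mindex s -> R -> E -> E -> C) (a b : mindex s) (q : nat) :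
  (forall (c : R) z w, pr (c *: z + w) = c * pr z + pr w) ->
  (forall z, `|pr z| <= `|z|) ->
  x_derivatives Omega phi d ->
  (forall K a, compact_in K Omega ->
    D_bounded setT [set psi | exists e x, [/\ I01 e, K x & psi = d a e x]]) ->
  unif_bigO Omega (fun e x => pmoment pr a (phi e x)) (fun e => e ^+ q.+1) ->
  unif_bigO Omega (fun e x => pmoment pr a (d b e x)) (fun e => e ^+ q).
Proof.
move=> prl prle dphi dB phi0.
pose n := mi_size b.
pose eta (e : R) := e `^ (n.+1%:R)^-1.
have eta0 e : 0 < e -> 0 < eta e by exact: powR_gt0.
have etaX e k : 0 < e -> eta e ^+ (n.+1 * k) = e ^+ k.
  by move=> e0; rewrite exprM rootK.
have dD b' e x : I01 e -> Omega x -> D setT (d b' e x).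
  move=> Ie Ox; have xO : compact_in [set x] Omega.
    by split; [exact: compact_set1 | move=> _ ->].
  by apply: (dB _ b' xO).1; exists e, x.
have bigb : unif_bigO Omega (fun e x => pmoment pr a (d b e x))
    (fun e => eta e ^+ (n.+1 * q.+1 - n)).
  apply: (mixed_interpolation Omega_open eta0 (root_cvg0 n)
    (U := fun b e x => pmoment pr a (d b e x))).
  - move=> b' i e x Ie Ox.
    apply: (pmoment_is_derive prl prle _ Omega_open Ox) => [y Oy|].
      exact: dD.
    by have [_] := dphi e x Ie Ox; apply.
  - move=> b' K Kc.
    have [_ /(_ _ (pmoment_seminorm prl prle a))[M KM]] := dB K b' Kc.
    exists M; near=> e => x Kx; rewrite mulr1; apply: KM; exists e, x; split => //.
    rewrite /I01 /=; apply/andP.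
    by split; near: e; [exact: nbhs_right_gt|exact: nbhs_right_le].
  - move=> K Kc; have [c cK] := phi0 K Kc; exists c; near=> e => x Kx.
    have e0 : 0 < e by near: e; exact: nbhs_right_gt.
    have Ie : I01 e by rewrite /I01 /= e0; near: e; exact: nbhs_right_le.
    rewrite etaX// (dphi e x Ie (Kc.2 x Kx)).1; move: x Kx; near: e; exact: cK.
move=> K Kc; have [c cK] := bigb K Kc; exists `|c|; near=> e => x Kx.
have e0 : 0 < e by near: e; exact: nbhs_right_gt.
have e1 : eta e <= 1 by near: e; apply: root_cvg0.
apply: (@le_trans _ _ (c * eta e ^+ (n.+1 * q.+1 - n))).
  by move: x Kx; near: e; exact: cK.
(* One power of eta is left over and is bounded by 1. *)
have -> : (n.+1 * q.+1 - n = (n.+1 * q).+1)%N by rewrite mulnS addSn -addnS addKn.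
rewrite -[e ^+ q]etaX//; apply: le_trans (ler_norm _) _.
rewrite normrM ler_wpM2l// ger0_norm ?exprn_ge0 ?powR_ge0//.
by rewrite exprS ler_piMl// exprn_ge0 ?powR_ge0.
Unshelve. all: by end_near. Qed.

(** The derivatives d witnessing that phi is a test object also witness the
    stronger type; real and imaginary parts are interpolated separately. *)
Lemma type_Ag_infty_of_type_Ag (q : nat) (phi : R -> E -> E -> C) :
  type_Ag Omega q.+1 phi -> type_Ag_infty Omega q phi.
Proof.
case=> [[phis [d dphi dB]] phiq]; split; first by split => //; exists d.
exists d => // L b a Lc /andP[a1 aq].
have part (pr : C -> R) : (forall (c : R) z w, pr (c *: z + w) = c * pr z + pr w) ->
    (forall z, `|pr z| <= `|z|) ->
    (forall psi, pmoment pr a psi = pr (moment a psi)) ->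
    exists c, \forall e \near 0^'+, forall x, L x ->
      `|pmoment pr a (d b e x)| <= c * e ^+ q.
  move=> prl prle prE; apply: (pmoment_interpolation b prl prle dphi dB _ Lc).
  move=> K Kc; have [|c cK] := phiq K a Kc; first by rewrite a1 leqW.
  exists c; move: cK; apply: filterS => e cK x Kx; rewrite prE.
  exact: le_trans (prle _) (cK x Kx).
have [c1 C1] := part _ Re_linear Re_le (fun=> erefl).
have [c2 C2] := part _ Im_linear Im_le (fun=> erefl).
exists (c1 + c2); near=> e => x Lx; apply: le_trans (norm_le_ReIm _) _.
rewrite mulrDl; apply: lerD.
  by move: x Lx; near: e; exact: C1.
by move: x Lx; near: e; exact: C2.
Unshelve. all: by end_near. Qed.

Lemma type_Ag_of_type_Ag_infty (q : nat) (phi : R -> E -> E -> C) :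
  type_Ag_infty Omega q phi -> type_Ag Omega q phi.
Proof.
case=> [tphi [d dphi dq]]; split => // L a Lc aq.
have [c cL] := dq L (fun=> 0%N) a Lc aq.
exists c; near=> e => x Lx.
have Ie : I01 e.
  rewrite /I01 /=; apply/andP.
    by split; near: e; [exact: nbhs_right_gt|exact: nbhs_right_le].
rewrite -(dphi e x Ie (Lc.2 x Lx)).1; move: x Lx; near: e; exact: cL.
Unshelve. all: by end_near. Qed.

End Comparison.

Theorem corollary16p8 (R : realType) (s : nat) (Omega : set 'rV[R]_s)
    (F : ('rV[R]_s -> Rcomplex R) * 'rV[R]_s -> Rcomplex R)
    (Omega_open : open Omega) (F_basic : basic_space Omega F) :
  (moderate (type_Ag Omega) Omega F <->
     moderate (type_Ag_infty Omega) Omega F) /\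
  (negligible_wrt (type_Ag Omega) Omega F <->
     negligible_wrt (type_Ag_infty Omega) Omega F).
Proof.
split; split.
- move=> FM K a Kc; have [N N0 FN] := FM K a Kc; exists N => // phi phiN.
  by apply: FN; exact: type_Ag_of_type_Ag_infty.
- move=> FM K a Kc; have [N N0 FN] := FM K a Kc; exists N.+1 => // phi phiN.
  (* For e <= 1 the bound of order e^-N implies the one of order e^-(N+1). *)
  have [c cK] := FN _ (type_Ag_infty_of_type_Ag Omega_open phiN).
  exists `|c|; near=> e => x Kx.
  have e0 : 0 < e by near: e; exact: nbhs_right_gt.
  have e1 : e <= 1 by near: e; exact: nbhs_right_le.
  apply: (@le_trans _ _ (c * e ^- N)); first by move: x Kx; near: e; exact: cK.
  apply: (@le_trans _ _ (`|c| * e ^- N)).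
    by rewrite ler_wpM2r ?ler_norm// invr_ge0 exprn_ge0// ltW.
  rewrite ler_wpM2l// lef_pV2 ?posrE ?exprn_gt0// exprS ler_piMl//.
  by rewrite exprn_ge0// ltW.
- move=> FM K a n Kc n0; have [q q0 Fq] := FM K a n Kc n0; exists q => // phi phiq.
  by apply: Fq; exact: type_Ag_of_type_Ag_infty.
- move=> FM K a n Kc n0; have [q q0 Fq] := FM K a n Kc n0.
  exists q.+1 => // phi phiq.
  by apply: Fq; exact: type_Ag_infty_of_type_Ag.
Unshelve. all: by end_near. Qed.
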